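(* Let $q$ be an indeterminate and let $m,n,r\geq 0$ and $k\ge0$ be integers. Then $$c_q^{(r)}(m+n,k)=\sum_{i=0}^n \sum_{j=0}^m [m+r]_q^{\overline{n-i}}\binom{n}{i}_q c_q^{(r)}(m,j)\,c_q(i,k-j)$$ and $$\prod_{\ell=0}^{n-1}(1+[\ell+m+r]_q)=\sum_{i=0}^n [m+r]_q^{\overline{n-i}}\binom{n}{i}_q \prod_{\ell=0}^{i-1}(1+\ell_q).$$
   Context: For an integer $a\ge1$, $a_q=[a]_q=1+q+\cdots+q^{a-1}$, $0_q=0$, $a_q!=\prod_{i=1}^a i_q$, $0_q!=1$; $\binom{n}{k}_q=\frac{n_q!}{k_q!(n-k)_q!}$ for $0\le k\le n$, $\binom{n}{0}_q=1$ for all $n$, and $0$ otherwise; $[a]_q^{\overline{b}}=\prod_{i=a}^{a+b-1}i_q$ for $b\ge1$ and $[a]_q^{\overline{0}}=1$. Write a permutation $\pi$ of a finite set of positive integers in standard cycle form $C_1/C_2/\cdots/C_k$: each cycle written starting with its smallest element, and cycles ordered so that $\min C_1<\cdots<\min C_k$. Let $\mathrm{inv}_c(\pi)$ be the number of inversions of the word obtained by concatenating $C_1C_2\cdots C_k$ (erasing cycle dividers). Let $c_q(n,k)=\sum_\pi q^{\mathrm{inv}_c(\pi)}$ over permutations of $[n]$ with $k$ cycles (so $c_q(0,0)=1$ and $c_q(n,k)=0$ if $k>n$ or $k<0$). For $r\ge0$, let $\mathcal{G}^{(r)}_{n,k}$ be the set of permutations of $[n+r]$ with $k+r$ cycles in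 which $1,\dots,r$ lie in distinct cycles, and $c_q^{(r)}(n,k)=\sum_{\pi\in\mathcal{G}^{(r)}_{n,k}}q^{\mathrm{inv}_c(\pi)}$. *)

(* Defs.v *)
From HB Require Import structures.
From mathcomp Require Import all_boot all_order all_algebra all_fingroup.

Set Implicit Arguments.
Unset Strict Implicit.
Unset Printing Implicit Defensive.

Import GRing.Theory.
Local Open Scope ring_scope.

Definition qint (F : fieldType) (q : F) (a : nat) : F := \sum_(i < a) q ^+ i.

Definition qfact (F : fieldType) (q : F) (a : nat) : F :=
  \prod_(1 <= i < a.+1) qint q i.

Definition qbinom (F : fieldType) (q : F) (n k : nat) : F :=
  if (k <= n)%N then qfact q n / (qfact q k * qfact q (n - k)) else 0.

Definition qrising (F : fieldType) (q : F) (a b : nat) : F :=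
  \prod_(a <= i < a + b) qint q i.

(* Permutations of [n] = {1, ..., n} are elements of 'S_n, the ordinal i of
   'I_n standing for the integer i + 1. *)

Definition cycle_min (n : nat) (s : 'S_n) (i : 'I_n) : bool :=
  [forall j in porbit s i, (i <= j)%N].

(* The standard cycle form C_1/C_2/.../C_k: enum 'I_n is increasing, so the
   cycles come by increasing minimum, each one written from its minimum. *)
Definition std_cycle_form (n : nat) (s : 'S_n) : seq (seq 'I_n) :=
  [seq traject s i #|porbit s i| | i <- enum 'I_n & cycle_min s i].

Definition word_inv (w : seq nat) : nat :=
  #|[set p : 'I_(size w) * 'I_(size w) |
      (p.1 < p.2)%N && (nth 0%N w p.2 < nth 0%N w p.1)%N]|.

Definition inv_c (n : nat) (s : 'S_n) : nat :=
  word_inv (map (@nat_of_ord n) (flatten (std_cycle_form s))).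

(* The number of cycles k is an integer, so that the sums below are 0 when k is
   negative. *)
Definition cq (F : fieldType) (q : F) (n : nat) (k : int) : F :=
  \sum_(s : 'S_n | #|porbits s|%:Z == k) q ^+ inv_c s.

Definition cqr_perms (r n : nat) (k : int) : {set 'S_(n + r)} :=
  [set s : 'S_(n + r) | (#|porbits s|%:Z == k + r%:Z) &&
    [forall i : 'I_(n + r), forall j : 'I_(n + r),
      [&& (i < r)%N, (j < r)%N & i != j] ==> (porbit s i != porbit s j)]].

Definition cqr (F : fieldType) (q : F) (r n : nat) (k : int) : F :=
  \sum_(s in cqr_perms r n k) q ^+ inv_c s.

(* The indeterminate q, in the field Q(q) of rational functions. *)
Definition qvar : {fraction {poly rat}} := tofrac 'X.

(* Main.v *)
(** Every permutation of [n + 1] letters arises uniquely from one of [n] letters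
    by inserting the largest letter, either as a new fixed point or right after
    a letter [x] in its cycle. In the word of the standard cycle form the new
    letter is appended, respectively placed right after [x], so it creates as
    many inversions as there are letters after [x]. Summing over [x] gives
    [c(n + 1, k) = c(n, k - 1) + [n]_q c(n, k)], and the same with [n + r] for
    the [r]-version, because [1, ..., r] lie in distinct cycles exactly when
    each of them is the minimum of its cycle. Both identities then express
    [\prod_(l < n) (t + [a + l]_q)] in the basis [\prod_(l < i) (t + [l]_q)],
    which is an induction on [n] by the q-Pascal rule. *)

Require Import Defs.
From HB Require Import structures.
From mathcomp Require Import all_boot all_order all_algebra all_fingroup.
From mathcomp Require Import zify ring.

Set Implicit Arguments.
Unset Strict Implicit.
Unset Printing Implicit Defensive.

Import GRing.Theory.
Local Open Scope ring_scope.

Local Notation orbit := fingraph.orbit.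

(** * Inversions of words *)

Section Words.
Local Open Scope nat_scope.

Lemma word_inv_sum (w : seq nat) :
  word_inv w = \sum_(i < size w) \sum_(j < size w)
                 ((i < j) && (nth 0 w j < nth 0 w i)).
Proof.
rewrite /word_inv -sum1_card pair_big /= big_mkcond /=.
by apply: eq_bigr => p _; rewrite inE; case: ifP.
Qed.

Lemma word_inv_cons (a : nat) (w : seq nat) :
  word_inv (a :: w) = count (fun b => b < a) w + word_inv w.
Proof.
rewrite !word_inv_sum /= big_ord_recl; congr (_ + _).
  rewrite big_ord_recl /= add0n -sum1_count (big_nth 0) big_mkord [RHS]big_mkcond.
  by apply: eq_bigr => i _ /=; case: ifP.
apply: eq_bigr => i _; rewrite big_ord_recl /= add0n.
by apply: eq_bigr => j _; rewrite /= ltnS.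
Qed.

(** No letter of [u] exceeds [x] and every letter of [v] is smaller, so [x] is inverted exactly with
    the letters of [v]. *)
Lemma word_inv_insert_max (x : nat) (u v : seq nat) :
    {in u, forall a, a <= x} -> {in v, forall a, a < x} ->
  word_inv (u ++ x :: v) = word_inv (u ++ v) + size v.
Proof.
move=> ux vx; elim: u ux => [_|a u IH ux] /=.
  rewrite word_inv_cons addnC; congr (_ + _).
  by apply/eqP; rewrite -all_count; apply/allP.
rewrite !word_inv_cons IH => [|b bu]; last by apply: ux; rewrite inE bu orbT.
rewrite addnA !count_cat /= ltnNge ux ?inE ?eqxx //=.
Qed.

Lemma word_inv_sorted (w : seq nat) : sorted leq w -> word_inv w = 0.
Proof.
elim: w => [_|a w IH]; first by rewrite word_inv_sum big_ord0.
move=> aw; rewrite word_inv_cons IH ?(path_sorted aw) // addn0.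
apply/eqP; rewrite -leqn0 leqNgt -has_count; apply/hasPn => b bw.
by rewrite -leqNgt; apply: (allP (order_path_min leq_trans aw)).
Qed.

End Words.

(** * Orbits, cycle minima and the standard cycle form *)

Section Cycles.
Local Open Scope nat_scope.

Lemma mem_porbit_fconnect (T : finType) (s : {perm T}) (x y : T) :
  (y \in porbit s x) = fconnect s x y.
Proof.
apply/porbitP/idP => [[i ->]|xy]; first by rewrite permX fconnect_iter.
by exists (findex s x y); rewrite permX iter_findex.
Qed.

Lemma traject_porbit (T : finType) (s : {perm T}) (x : T) :
  traject s x #|porbit s x| = orbit s x.
Proof.
rewrite /orbit /fingraph.order; congr traject; apply: eq_card => y.
by rewrite mem_porbit_fconnect.
Qed.

Lemma orbit_fcycle (T : finType) (f : T -> T) (x : T) (p : seq T) :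
  fcycle f (x :: p) -> uniq (x :: p) -> orbit f x = x :: p.
Proof.
move=> fp up; rewrite /orbit (order_cycle fp up) ?mem_head //=.
congr (_ :: _); move: fp; rewrite /= rcons_path => /andP[/fpathP[m ->] _].
by rewrite size_traject.
Qed.

Variable n : nat.
Implicit Types (s : 'S_n) (i j : 'I_n).

Lemma cycle_minP s i :
  reflect (forall j, j \in orbit s i -> i <= j) (cycle_min s i).
Proof.
apply: (iffP forall_inP) => h j; have := h j;
  by rewrite mem_porbit_fconnect fconnect_orbit.
Qed.

Lemma cycle_min_inj s : {in cycle_min s &, injective (porbit s)}.
Proof.
move=> i j /forall_inP hi /forall_inP hj e.
apply/val_inj/anti_leq; rewrite hi ?hj //; first by rewrite -e porbit_id.
by rewrite e porbit_id.
Qed.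

Lemma cycle_min_ex s i : exists2 j, cycle_min s j & porbit s j = porbit s i.
Proof.
case: (@arg_minnP _ i (mem (porbit s i)) (@nat_of_ord n) (porbit_id s i)).
move=> j ji minj; have e : porbit s j = porbit s i.
  by apply/esym/eqP; rewrite eq_porbit_mem porbit_sym.
by exists j => //; apply/forall_inP => l; rewrite e; apply: minj.
Qed.

(** Each cycle has exactly one minimum. Counting minima makes the effect of an insertion visible
    letter by letter. *)
Lemma card_porbits s : #|porbits s| = \sum_(i < n) cycle_min s i.
Proof.
have -> : porbits s = [set porbit s i | i in cycle_min s].
  apply/setP => A; apply/imsetP/imsetP => [[i _ ->]|[i _ ->]]; last by exists i.
  by have [j mj e] := cycle_min_ex s i; exists j.
rewrite (card_in_imset (@cycle_min_inj s)) -sum1_card big_mkcond.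
by apply: eq_bigr => i _; rewrite -[i \in _]/(cycle_min s i); case: (cycle_min s i).
Qed.

(* Elements of an initial segment lie in distinct cycles exactly when each of
   them is the minimum of its cycle. *)
Definition min_upto (r : nat) s := [forall i : 'I_n, (i < r) ==> cycle_min s i].

(** If [i < r] is not minimal in its cycle, the minimum of that cycle is a second letter below [r]
    in it. Conversely, two minima of one cycle coincide. *)
Lemma distinct_cycles_min_upto r s :
  [forall i : 'I_n, forall j : 'I_n,
     [&& i < r, j < r & i != j] ==> (porbit s i != porbit s j)] = min_upto r s.
Proof.
apply/forallP/forallP => h i.
  apply/implyP => ir; have [j mj e] := cycle_min_ex s i.
  have ji : j <= i by move/forall_inP: mj => ->; rewrite // e porbit_id.
  have [<- //|ne] := eqVneq j i.
  have := forallP (h j) i.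
  by rewrite (leq_ltn_trans ji ir) ir ne /= e eqxx.
apply/forallP => j; apply/implyP => /and3P[ir jr].
by apply: contraNneq => /cycle_min_inj ->; rewrite // unfold_in;
   [move: (h i) | move: (h j)]; rewrite ?ir ?jr.
Qed.

Definition cycle_word s : seq 'I_n := flatten (std_cycle_form s).

Lemma std_cycle_formE s :
  std_cycle_form s = [seq orbit s i | i <- enum 'I_n & cycle_min s i].
Proof. by apply: eq_map => i; rewrite traject_porbit. Qed.

End Cycles.

(** * Insertion of the largest letter and its effect on cycles and inversions *)

Section Insertion.
Local Open Scope nat_scope.
Variable n : nat.
Implicit Types (s : 'S_n) (y : 'I_n.+1) (i z : 'I_n) (c : seq 'I_n).

Local Notation "^ z" := (lift (@ord_max n) z) (at level 10).

(* Puts the new largest letter right after [y] in its cycle, or makes it a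
   fixed point when [y] is that letter itself. *)
Definition insert_max y s : 'S_n.+1 :=
  (tperm y ord_max * lift_perm ord_max ord_max s)%g.

Lemma insert_max_lift y s z :
  insert_max y s (^ z) = if ^ z == y then ord_max else ^ (s z).
Proof.
rewrite permM; case: tpermP => [->|/eqP|/eqP ne _].
- by rewrite eqxx lift_perm_id.
- by rewrite eq_sym (negPf (neq_lift _ _)).
- by rewrite (negPf ne) lift_perm_lift.
Qed.

Lemma insert_max_max y s :
  insert_max y s ord_max = lift_perm ord_max ord_max s y.
Proof. by rewrite permM tpermR. Qed.

Lemma insert_max_preim y s : insert_max y s y = ord_max.
Proof. by rewrite permM tpermL lift_perm_id. Qed.

(** The letter [y] is recovered as the preimage of [ord_max], then [s] by cancellation; the
    cardinalities agree since [(n + 1) * n! = (n + 1)!]. *)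
Lemma insert_max_bij :
  bijective (fun p : 'I_n.+1 * 'S_n => insert_max p.1 p.2).
Proof.
apply: inj_card_bij => [[y s] [y' s'] /= e|]; last first.
  by rewrite card_prod card_ord !card_Sn factS.
have ey : y = y'.
  by apply: (@perm_inj _ (insert_max y s)); rewrite insert_max_preim e insert_max_preim.
subst y'; congr pair; apply/permP => z; apply: (@lift_inj _ ord_max).
by move/mulgI/permP: e => /(_ (^ z)); rewrite !lift_perm_lift.
Qed.

(** The effect of the insertion on one letter of a word: [ord_max] follows the letter if that letter
    is [y]. *)
Definition expand_letter y z : seq 'I_n.+1 :=
  ^ z :: (if ^ z == y then [:: ord_max] else [::]).

Definition expand_word y c := flatten (map (expand_letter y) c).

Lemma mem_expand_word_lift y c z : (^ z \in expand_word y c) = (z \in c).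
Proof.
elim: c => //= a c IH; rewrite /expand_word /= -/(expand_word y c).
rewrite !inE mem_cat IH (inj_eq lift_inj); congr (_ || _).
case: ifP => _ //; by rewrite inE eq_sym (negPf (neq_lift _ _)).
Qed.

Lemma mem_expand_word_max y c :
  (ord_max \in expand_word y c) = has (fun z => ^ z == y) c.
Proof.
elim: c => //= a c IH; rewrite /expand_word /= -/(expand_word y c).
rewrite !inE mem_cat IH (negPf (neq_lift _ _)) /=.
by case: ifP => _ //; rewrite inE eqxx.
Qed.

Lemma uniq_expand_word y c : uniq c -> uniq (expand_word y c).
Proof.
elim: c => //= a c IH /andP[ac uc]; rewrite /expand_word /= -/(expand_word y c).
rewrite mem_cat mem_expand_word_lift (negPf ac) orbF cat_uniq IH // andbT.
case: ifP => [/eqP ay|_] /=; last by rewrite has_pred0.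
rewrite inE eq_sym (negPf (neq_lift _ _)) /= has_sym /= orbF mem_expand_word_max.
apply/hasPn => b bc; rewrite -ay (inj_eq lift_inj).
by apply: contraNneq ac => <-.
Qed.

(** A step of [s] lifts to one step, or to two steps through [ord_max] when it leaves [y]. The
    second conclusion is what closes the path into a cycle. *)
Lemma fpath_expand_word y s z c : fpath s z c ->
  let p := behead (expand_letter y z) ++ expand_word y c in
  fpath (insert_max y s) (^ z) p /\
  insert_max y s (last (^ z) p) = ^ (s (last z c)).
Proof.
have step a : fpath (insert_max y s) (^ a) (behead (expand_letter y a)) /\
    insert_max y s (last (^ a) (behead (expand_letter y a))) = ^ (s a).
  rewrite /=; case: ifP => [/eqP e|ne] /=; rewrite insert_max_lift ?e ?ne ?eqxx //.
  by rewrite insert_max_max -e lift_perm_lift.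
elim: c z => [z _|a c IH z] /=; first by rewrite cats0; apply: step.
case/andP => /eqP sz sc; have [p1 e1] := step z; have [p2 e2] := IH a sc.
rewrite /expand_word /= -/(expand_word y c).
by rewrite cat_path p1 last_cat /= {1}/frel /= e1 sz eqxx p2.
Qed.

Lemma orbit_insert_max_lift y s z :
  orbit (insert_max y s) (^ z) = expand_word y (orbit s z).
Proof.
have cyc := cycle_orbit (@perm_inj _ s) z; have u := orbit_uniq s z.
case e : (orbit s z) cyc u => [|a c]; first by have := in_orbit s z; rewrite e.
have <- : z = a by move: e; rewrite /orbit -orderSpred => -[].
rewrite [fcycle _ _]/= rcons_path => /andP[pc /eqP lc] u.
rewrite /expand_word /= -/(expand_word y c).
have [p1 e1] := fpath_expand_word y pc.
apply: orbit_fcycle; last exact: (uniq_expand_word y u).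
by rewrite /= rcons_path p1 /= e1 lc.
Qed.

Lemma cycle_min_insert_lift y s z : cycle_min (insert_max y s) (^ z) = cycle_min s z.
Proof.
apply/cycle_minP/cycle_minP; rewrite orbit_insert_max_lift => h j.
  by move=> jz; have := h (^ j); rewrite mem_expand_word_lift !lift_max; apply.
case: (unliftP ord_max j) => [i ->|-> _]; last by rewrite lift_max ltnW.
by rewrite mem_expand_word_lift !lift_max; apply: h.
Qed.

(** The cycle of [ord_max] contains its preimage [y], which is smaller unless the two are equal. *)
Lemma cycle_min_insert_max y s : cycle_min (insert_max y s) ord_max = (y == ord_max).
Proof.
apply/cycle_minP/eqP => [h|->].
  have := h y; rewrite -fconnect_orbit fconnect_sym; last exact: perm_inj.
  rewrite -{1}(insert_max_preim y s) fconnect1 => /(_ isT) hy.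
  by apply/val_inj/anti_leq; rewrite hy leq_ord.
move=> j; rewrite (@orbit_fcycle _ _ ord_max [::]) //=.
  by rewrite inE => /eqP ->.
by rewrite insert_max_preim eqxx.
Qed.

Lemma widen_ord_lift_max z : widen_ord (leqnSn n) z = ^ z.
Proof. by apply: val_inj; exact/esym/lift_max. Qed.

Lemma card_porbits_insert_max y s :
  #|porbits (insert_max y s)| = #|porbits s| + (y == ord_max).
Proof.
rewrite !card_porbits big_ord_recr /= cycle_min_insert_max; congr (_ + _).
by apply: eq_bigr => z _; rewrite widen_ord_lift_max cycle_min_insert_lift.
Qed.

Lemma min_upto_insert_max r y s :
  r <= n -> min_upto r (insert_max y s) = min_upto r s.
Proof.
move=> rn; apply/forallP/forallP => h i.
  by have := h (^ i); rewrite lift_max cycle_min_insert_lift.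
case: (unliftP ord_max i) => [j ->|->]; last by rewrite /= ltnNge rn.
by rewrite lift_max cycle_min_insert_lift.
Qed.

(** A new fixed point has the largest minimum, so its cycle is written last; otherwise the order of
    the cycles is unchanged. *)
Lemma cycle_word_insert_max y s :
  cycle_word (insert_max y s) =
    expand_word y (cycle_word s) ++ (if y == ord_max then [:: ord_max] else [::]).
Proof.
rewrite /cycle_word !std_cycle_formE enum_ordSr filter_rcons cycle_min_insert_max.
rewrite (eq_map widen_ord_lift_max) filter_map.
rewrite (eq_filter (cycle_min_insert_lift y s)).
have lifted w : flatten [seq orbit (insert_max y s) j | j <- map (lift ord_max) w]
    = expand_word y (flatten [seq orbit s i | i <- w]).
  elim: w => //= a w IH.
  by rewrite orbit_insert_max_lift IH /expand_word map_cat flatten_cat.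
case: ifP => [/eqP ey|_]; last by rewrite lifted cats0.
rewrite map_rcons flatten_rcons lifted (@orbit_fcycle _ _ ord_max [::]) //=.
by rewrite ey insert_max_preim eqxx.
Qed.

Lemma expand_word_notin y c :
  {in c, forall z, ^ z != y} -> expand_word y c = map (lift ord_max) c.
Proof.
elim: c => //= a c IH h; rewrite /expand_word /= -/(expand_word y c).
rewrite (negPf (h a (mem_head _ _))) IH // => z zc.
by apply: h; rewrite inE zc orbT.
Qed.

Lemma val_map_lift_max c :
  map (@nat_of_ord n.+1) (map (lift ord_max) c) = map (@nat_of_ord n) c.
Proof. by rewrite -map_comp; apply: eq_map => z; exact: lift_max. Qed.

Lemma inv_c_insert_max_fixed s : inv_c (insert_max ord_max s) = inv_c s.
Proof.
rewrite /inv_c -!/(cycle_word _) cycle_word_insert_max eqxx.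
rewrite expand_word_notin => [|z _]; last by rewrite eq_sym neq_lift.
rewrite map_cat val_map_lift_max /= word_inv_insert_max //=.
  by rewrite cats0 addn0.
by move=> a /mapP[z _ ->]; rewrite ltnW.
Qed.

Lemma inv_c_insert_max_lift s z :
    uniq (cycle_word s) -> z \in cycle_word s ->
  inv_c (insert_max (^ z) s) =
    inv_c s + (size (cycle_word s) - (index z (cycle_word s)).+1).
Proof.
rewrite /inv_c -!/(cycle_word _) cycle_word_insert_max => u /splitPr.
rewrite eq_sym (negPf (neq_lift _ _)) cats0.
case e : _ / => [A B]; move: u; rewrite {}e cat_uniq /= => /and3P[_ zAB /andP[zB _]].
have {zAB} zA : z \notin A by apply: contra zAB => /= ->.
rewrite /expand_word map_cat flatten_cat /= eqxx -!/(expand_word _ _).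
rewrite !expand_word_notin; first last.
- by move=> a aA; rewrite (inj_eq lift_inj); apply: contraNneq zA => <-.
- by move=> a aB; rewrite (inj_eq lift_inj); apply: contraNneq zB => <-.
rewrite index_cat (negPf zA) /= eqxx addn0 size_cat /= addnS subSS addKn.
(* The letter [z] joins the prefix [A], so that exactly [B] stands behind the new maximum. *)
rewrite !map_cat !map_cons !val_map_lift_max lift_max -cat_rcons.
rewrite word_inv_insert_max ?size_map ?cat_rcons // => a.
  by rewrite mem_rcons -map_cons => /mapP[b _ ->]; rewrite ltnW.
by move=> /mapP[b _ ->].
Qed.

End Insertion.

(** Induction on [n]: every permutation of [n.+1] letters is an insertion, which adds [ord_max] once
    to the word. *)
Lemma perm_eq_cycle_word (n : nat) (s : 'S_n) : perm_eq (cycle_word s) (enum 'I_n).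
Proof.
suff [u h] : uniq (cycle_word s) /\ forall z, z \in cycle_word s.
  by apply: uniq_perm; rewrite ?enum_uniq // => z; rewrite mem_enum h.
elim: n s => [|n IH] s.
  split; last by case.
  by case: (cycle_word s) => // -[].
have [g _ gK] := insert_max_bij n; rewrite -(gK s); case: (g s) => y t /=.
have [ut ht] := IH t; rewrite cycle_word_insert_max; split.
  rewrite cat_uniq uniq_expand_word //=; case: eqP => [->|_] //=; rewrite orbF andbT.
  by rewrite mem_expand_word_max; apply/hasPn => z _; rewrite eq_sym neq_lift.
move=> z; rewrite mem_cat; case: (unliftP ord_max z) => [i ->|->].
  by rewrite mem_expand_word_lift ht.
rewrite mem_expand_word_max; case: (unliftP ord_max y) => [i ->|->].
  by apply/orP; left; apply/hasP; exists i.
by rewrite eqxx inE eqxx orbT.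
Qed.

(** * Recurrences for the [q]-Stirling numbers *)

Section Recurrence.
Variables (F : fieldType) (q : F).

(** Common form of [cq] (at [r = 0]) and [cqr]; here [n] and [k] count all letters and all cycles,
    including the [r] special ones. *)
Definition min_cq (r n : nat) (k : int) : F :=
  \sum_(s : 'S_n | (#|porbits s|%:Z == k) && min_upto r s) q ^+ inv_c s.

(** The number of letters behind [z] takes each value below [n] once. *)
Lemma sum_exp_index (n : nat) (w : seq 'I_n) : perm_eq w (enum 'I_n) ->
  \sum_(z < n) q ^+ (size w - (index z w).+1)%N = qint q n.
Proof.
move=> pw; have sw : size w = n by rewrite (perm_size pw) size_enum_ord.
have uw : uniq w by rewrite (perm_uniq pw) enum_uniq.
rewrite -big_enum -(perm_big _ pw) /=.
case: n w pw sw uw => [|n] w pw sw uw.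
  by rewrite (size0nil sw) big_nil /qint big_ord0.
rewrite (big_nth ord0) big_mkord sw /qint [RHS](reindex_inj rev_ord_inj) /=.
by apply: eq_bigr => i _; rewrite index_uniq // sw.
Qed.

Lemma min_cqS (r n : nat) (k : int) : (r <= n)%N ->
  min_cq r n.+1 k = min_cq r n (k - 1) + qint q n * min_cq r n k.
Proof.
move=> rn; rewrite /min_cq (reindex _ (onW_bij _ (insert_max_bij n))) /=.
rewrite big_mkcond /= -(pair_bigA _ (fun y s =>
  if (#|porbits (insert_max y s)|%:Z == k) && min_upto r (insert_max y s)
  then q ^+ inv_c (insert_max y s) else 0)) /=.
(* The summand [y = ord_max] is the new fixed point; the others insert after an old letter. *)
rewrite big_ord_recr /= addrC; congr (_ + _).
  rewrite [RHS]big_mkcond; apply: eq_bigr => s _.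
  rewrite min_upto_insert_max // card_porbits_insert_max eqxx.
  by rewrite inv_c_insert_max_fixed PoszD eq_sym -subr_eq eq_sym.
rewrite exchange_big mulr_sumr [RHS]big_mkcond; apply: eq_bigr => s _ /=.
have pw := perm_eq_cycle_word s.
have uw : uniq (cycle_word s) by rewrite (perm_uniq pw) enum_uniq.
transitivity (\sum_(z < n) if (#|porbits s|%:Z == k) && min_upto r s
   then q ^+ (size (cycle_word s) - (index z (cycle_word s)).+1)%N * q ^+ inv_c s else 0).
  apply: eq_bigr => z _; rewrite widen_ord_lift_max min_upto_insert_max //.
  rewrite card_porbits_insert_max [_ == ord_max]eq_sym (negPf (neq_lift _ _)) addn0.
  rewrite inv_c_insert_max_lift // ?(perm_mem pw) ?mem_enum //.
  by rewrite exprD mulrC.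
case: ifP => _; last by rewrite big1.
by rewrite -mulr_suml sum_exp_index.
Qed.

(** Only the identity has all [r] letters as cycle minima; it has [r] cycles and an increasing
    word. *)
Lemma min_cq_diag (r : nat) (k : int) : min_cq r r k = (k == r%:Z)%:R.
Proof.
have mE (s : 'S_r) : min_upto r s = (s == 1%g).
  apply/idP/eqP => [/forallP h|->]; last first.
    apply/forallP => i; apply/implyP => _; apply/forall_inP => j.
    by case/porbitP=> e ->; rewrite expg1n perm1.
  apply/permP => i; rewrite perm1; apply: (@cycle_min_inj _ s).
  - by have := h (s i); rewrite ltn_ord.
  - by have := h i; rewrite ltn_ord.
  by apply/eqP; rewrite eq_porbit_mem (mem_porbit _ 1).
have min1 i : cycle_min (1 : 'S_r)%g i.
  by have := mE 1%g; rewrite eqxx => /forallP/(_ i); rewrite ltn_ord.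
have c1 : #|porbits (1 : 'S_r)%g| = r.
  by rewrite card_porbits (eq_bigr _ (fun i _ => congr1 nat_of_bool (min1 i)))
             sum_nat_const card_ord muln1.
have i1 : inv_c (1 : 'S_r)%g = 0%N.
  rewrite /inv_c std_cycle_formE (eq_filter (a2 := predT)) ?filter_predT => [|i];
    last exact: min1.
  rewrite (eq_map (g := fun i => [:: i])) => [|i]; last first.
    by apply: orbit_fcycle => //=; rewrite perm1 eqxx.
  rewrite flatten_seq1 val_enum_ord word_inv_sorted //; exact: iota_sorted.
rewrite /min_cq; under eq_bigl => s do rewrite mE andbC.
rewrite big_mkcondr big_pred1_eq c1 i1 expr0 eq_sym.
by case: eqP.
Qed.

Lemma cq_min_cq (n : nat) (k : int) : cq q n k = min_cq 0 n k.
Proof.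
apply: eq_bigl => s; rewrite andbC.
by have -> : min_upto 0 s by apply/forallP.
Qed.

Lemma cqr_min_cq (r n : nat) (k : int) : cqr q r n k = min_cq r (n + r) (k + r%:Z).
Proof. by apply: eq_bigl => s; rewrite inE distinct_cycles_min_upto. Qed.

Lemma cq0 (k : int) : cq q 0 k = (k == 0)%:R.
Proof. by rewrite cq_min_cq min_cq_diag. Qed.

Lemma cqS (n : nat) (k : int) : cq q n.+1 k = cq q n (k - 1) + qint q n * cq q n k.
Proof. by rewrite !cq_min_cq min_cqS. Qed.

Lemma cqr0 (r : nat) (k : int) : cqr q r 0 k = (k == 0)%:R.
Proof. by rewrite cqr_min_cq min_cq_diag -subr_eq0 addrK. Qed.

Lemma cqrS (r n : nat) (k : int) :
  cqr q r n.+1 k = cqr q r n (k - 1) + qint q (n + r) * cqr q r n k.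
Proof. by rewrite !cqr_min_cq addSn min_cqS ?leq_addl // addrAC. Qed.

Lemma cqr_gt (r n : nat) (k : int) : (n%:Z < k)%R -> cqr q r n k = 0.
Proof.
elim: n k => [|n IH] k nk; first by rewrite cqr0; case: eqP nk => // ->.
by rewrite cqrS !IH ?mulr0 ?addr0 //; lia.
Qed.

Lemma cqr_lt0 (r n : nat) (k : int) : (k < 0)%R -> cqr q r n k = 0.
Proof.
elim: n k => [|n IH] k nk; first by rewrite cqr0; case: eqP nk => // ->.
by rewrite cqrS !IH ?mulr0 ?addr0 //; lia.
Qed.

(** Only [j = k] survives, and for [k] outside [0..m] both sides vanish. This is the case [n = 0] of
    the convolution. *)
Lemma cqr_conv_cq0 (r m : nat) (k : int) :
  \sum_(j < m.+1) cqr q r m j%:Z * cq q 0 (k - j%:Z) = cqr q r m k.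
Proof.
have [k0|k0] := boolP (k < 0)%R.
  rewrite cqr_lt0 // big1 // => j _; rewrite cq0 subr_eq0.
  by case: eqP => [e|]; rewrite ?mulr0 //; lia.
have [k' e] : exists k' : nat, k = k'%:Z by exists `|k|%N; lia.
rewrite {k0}e; have [km|mk] := leqP k' m.
  rewrite (bigD1 (Ordinal (km : k' < m.+1)%N)) //= cq0 subrr eqxx mulr1.
  rewrite big1 ?addr0 // => j; rewrite -val_eqE /= cq0 subr_eq0 eqz_nat eq_sym.
  by move/negPf => ->; rewrite mulr0.
rewrite cqr_gt // big1 // => j _; rewrite cq0 subr_eq0 eqz_nat.
case: eqP => [e|]; last by rewrite mulr0.
by have := ltn_ord j; rewrite -e ltnS leqNgt mk.
Qed.

(** * [q]-integers and the [q]-Pascal rule *)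

Lemma qintD (a b : nat) : qint q (a + b) = qint q a + q ^+ a * qint q b.
Proof.
rewrite /qint big_split_ord /= mulr_sumr; congr (_ + _).
by apply: eq_bigr => i _; rewrite exprD.
Qed.

Lemma qfact0 : qfact q 0 = 1.
Proof. by rewrite /qfact big_geq. Qed.

Lemma qfactS (n : nat) : qfact q n.+1 = qfact q n * qint q n.+1.
Proof. by rewrite /qfact big_nat_recr. Qed.

Lemma qrisingS (a b : nat) : qrising q a b.+1 = qrising q a b * qint q (a + b).
Proof. by rewrite /qrising addnS big_nat_recr //= leq_addr. Qed.

Hypothesis qintS_neq0 : forall a, qint q a.+1 != 0.

Lemma qfact_neq0 (n : nat) : qfact q n != 0.
Proof. by elim: n => [|n IH]; rewrite ?qfact0 ?oner_eq0 // qfactS mulf_neq0. Qed.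

Lemma qbinom0 (n : nat) : qbinom q n 0 = 1.
Proof. by rewrite /qbinom /= subn0 qfact0 mul1r divff ?qfact_neq0. Qed.

Lemma qbinomnn (n : nat) : qbinom q n n = 1.
Proof. by rewrite /qbinom leqnn subnn qfact0 mulr1 divff ?qfact_neq0. Qed.

Lemma qbinom_gt (n i : nat) : (n < i)%N -> qbinom q n i = 0.
Proof. by rewrite /qbinom ltnNge => /negPf ->. Qed.

(** Comes from splitting [qint q n.+1] as [qint q i.+1 + q ^+ i.+1 * qint q (n - i)]. *)
Lemma qbinomSS (n i : nat) : (i <= n)%N ->
  qbinom q n.+1 i.+1 = q ^+ i.+1 * qbinom q n i.+1 + qbinom q n i.
Proof.
move=> le_in; have f0 := qfact_neq0.
(* At [i = n] the upper term is the default value 0 of [qbinom]. *)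
have [lt_in|] := ltnP i n; last first.
  move=> le_ni; have -> : i = n by apply/anti_leq/andP.
  by rewrite (qbinom_gt (ltnSn n)) mulr0 add0r !qbinomnn.
rewrite /qbinom ltnS le_in lt_in subSS.
have -> : (n - i = (n - i.+1).+1)%N by lia.
set d := (n - i.+1)%N; rewrite (qfactS n) (qfactS i) (qfactS d).
have -> : qint q n.+1 = qint q i.+1 + q ^+ i.+1 * qint q d.+1.
  by rewrite -qintD; congr qint; lia.
by field; rewrite !f0 !qintS_neq0.
Qed.

(* With [G i k] the coefficient of [t ^+ k], the hypotheses say
   [G n = E 0 * \prod_(l < n) (t + qint q (a + l))] and
   [E i = E 0 * \prod_(l < i) (t + qint q l)]; the induction step rests on
   [t + qint q (a + n) = (t + qint q i) + q ^+ i * qint q (a + n - i)]. *)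
Lemma rising_expansion (a : nat) (G E : nat -> int -> F) :
    (forall k, G 0%N k = E 0%N k) ->
    (forall n k, G n.+1 k = G n (k - 1) + qint q (a + n) * G n k) ->
    (forall i k, E i.+1 k = E i (k - 1) + qint q i * E i k) ->
  forall n k,
    G n k = \sum_(i < n.+1) qrising q a (n - i) * qbinom q n i * E i k.
Proof.
move=> G0 GS ES; elim=> [|n IH] k.
  by rewrite big_ord1 qbinom0 /qrising addn0 big_geq // !mul1r.
(* The part [t + qint q i] of the factor turns [E i] into [E i.+1]; the rest lengthens the rising
   product. *)
have -> : G n.+1 k =
    \sum_(i < n.+1) qrising q a (n - i) * qbinom q n i * E i.+1 k +
    \sum_(i < n.+1) qrising q a (n.+1 - i) * (q ^+ i * qbinom q n i) * E i k.
  rewrite GS !IH mulr_sumr -!big_split; apply: eq_bigr => i _ /=.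
  rewrite ES subSn ?leq_ord // qrisingS.
  have -> : qint q (a + n) = qint q i + q ^+ i * qint q (a + (n - i)).
    by rewrite -qintD; congr qint; have := leq_ord i; lia.
  by ring.
(* With the term [i = 0] set apart, [q]-Pascal splits the others; the second half is the second sum
   above, shifted by one. *)
rewrite [RHS]big_ord_recl /= [X in _ = _ + X](eq_bigr (fun i : 'I_n.+1 =>
  qrising q a (n - i) * qbinom q n i * E i.+1 k +
  qrising q a (n - i) * (q ^+ i.+1 * qbinom q n i.+1) * E i.+1 k)); last first.
  by move=> i _; rewrite /= subSS qbinomSS ?leq_ord //; ring.
rewrite big_split /= addrCA; congr (_ + _).
rewrite [in RHS]big_ord_recr /= (qbinom_gt (ltnSn n)) !mulr0 mul0r addr0.
by rewrite big_ord_recl /= !qbinom0 expr0 mulr1.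
Qed.

(** * The two identities *)

(** The recurrence of [cq] in [i] is linear, so its convolution with the fixed family [cqr q r m]
    satisfies it too and can serve as [E]. *)
Lemma cqr_convolution (m n r : nat) (k : int) :
  cqr q r (m + n) k =
    \sum_(i < n.+1) \sum_(j < m.+1)
      qrising q (m + r) (n - i) * qbinom q n i * cqr q r m j%:Z * cq q i (k - j%:Z).
Proof.
rewrite (@rising_expansion (m + r) (fun n k => cqr q r (m + n) k)
  (fun i k => \sum_(j < m.+1) cqr q r m j%:Z * cq q i (k - j%:Z))) /=.
- by apply: eq_bigr => i _; rewrite mulr_sumr; apply: eq_bigr => j _; rewrite mulrA.
- by move=> l; rewrite addn0 cqr_conv_cq0.
- by move=> i l; rewrite addnS cqrS addnAC.
move=> i l; rewrite mulr_sumr -big_split; apply: eq_bigr => j _ /=.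
by rewrite cqS addrAC; ring.
Qed.

(** Families constant in [k] make the shift to [k - 1] trivial, which amounts to [t = 1]. *)
Lemma qrising_convolution (m n r : nat) :
  \prod_(l < n) (1 + qint q (l + m + r)) =
    \sum_(i < n.+1) qrising q (m + r) (n - i) * qbinom q n i
      * \prod_(l < i) (1 + qint q l).
Proof.
apply: (@rising_expansion (m + r)
  (fun n _ => \prod_(l < n) (1 + qint q (l + m + r)))
  (fun i _ => \prod_(l < i) (1 + qint q l)) _ _ _ n 0).
- by move=> _; rewrite !big_ord0.
- by move=> l _; rewrite big_ord_recr /= (_ : m + r + l = l + m + r)%N; [ring|lia].
- by move=> l _; rewrite big_ord_recr /=; ring.
Qed.

End Recurrence.

(** As a polynomial in ['X] it has constant coefficient 1. This justifies the divisions in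
    [qbinom]. *)
Lemma qint_qvar_neq0 (a : nat) : qint qvar a.+1 != 0.
Proof.
rewrite /qint /qvar; under eq_bigr do rewrite -tofracXn.
rewrite -rmorph_sum tofrac_eq0; apply/eqP => /polyP/(_ 0%N).
rewrite coef_sum coef0 big_ord_recl expr0 coef1 big1 ?addr0 => [|i _].
  by move/eqP; rewrite oner_eq0.
by rewrite coefXn.
Qed.

Theorem theorem2p6 (m n r k : nat) :
  cqr qvar r (m + n) k%:Z =
    \sum_(i < n.+1) \sum_(j < m.+1)
      qrising qvar (m + r) (n - i) * qbinom qvar n i
        * cqr qvar r m j%:Z * cq qvar i (k%:Z - j%:Z)
  /\
  \prod_(l < n) (1 + qint qvar (l + m + r)) =
    \sum_(i < n.+1)
      qrising qvar (m + r) (n - i) * qbinom qvar n i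
        * \prod_(l < i) (1 + qint qvar l).
Proof.
split; first exact/cqr_convolution/qint_qvar_neq0.
exact/qrising_convolution/qint_qvar_neq0.
Qed.
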